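(* Let $\omega$ be the symmetric sum, $\omega(x,y,z) = x(y\circ z) + y(z\circ x) + z(x\circ y)$, where $u \circ v = \tfrac12(uv+vu)$. The Gelfand-Kirillov dimension of $U(A^\omega)$ is $1$.
   Context: $\mathbb{F}$ is a field of characteristic $0$. $A$ is the 2-dimensional space of $2\times 2$ matrices over $\mathbb{F}$ with zero diagonal, with basis $e_1 = \begin{bmatrix} 0&1\\0&0\end{bmatrix}$, $e_2 = \begin{bmatrix} 0&0\\1&0\end{bmatrix}$; it is closed under triple products $xyz$ of matrices. For a trilinear operation $\omega(x,y,z)$ (a fixed rational linear combination of the six products of $x,y,z$ in all orders), $A^\omega$ denotes the space $A$ with the trilinear operation $\omega$ computed using matrix multiplication. Let $\mathbb{F}\langle a,b\rangle$ be the free unital associative algebra and $\phi\colon A \to \mathbb{F}\langle a,b\rangle$ the linear map with $\phi(e_1)=a$, $\phi(e_2)=b$. The universal associative envelope is $U(A^\omega) = \mathbb{F}\langle a,b\rangle / I$, where $I$ is the two-sided ideal generated by the elements $\omega(\phi(x),\phi(y),\phi(z)) - \phi(\omega(x,y,z))$ for $x,y,z\in\{e_1,e_2\}$. The Gelfand-Kirillov dimension of a finitely generated algebra is $\limsup_{n\to\infty} \log_n \dim V^{(n)}$, where $V^{(n)}$ is the span of all products of at most $n$ generators (here the generators are the cosets of $a$ and $b$). *)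

(* Defs.v *)
From HB Require Import structures.
From mathcomp Require Import all_boot all_order all_algebra.
From mathcomp Require Import finmap.
(* The notations of monalg clash with those of mathcomp-analysis. *)
From mathcomp Require Import -(notations) monalg.
From mathcomp Require Import all_classical all_reals all_analysis.

Set Implicit Arguments.
Unset Strict Implicit.
Unset Printing Implicit Defensive.

Import Order.TTheory GRing.Theory Num.Theory.
Local Open Scope classical_set_scope.
Local Open Scope ring_scope.
Local Open Scope quotient_scope.

Section GKDimension.
Variable F : fieldType.

Section Dimension.
Variable V : lmodType F.

Definition lin_span (X : set V) : set V :=
  [set v | exists n (c : 'I_n -> F) (x : 'I_n -> V),
     (forall i, X (x i)) /\ v = \sum_i c i *: x i].

Definition lin_indep n (b : 'I_n -> V) : Prop :=
  forall c : 'I_n -> F, \sum_i c i *: b i = 0 -> forall i, c i = 0.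

Definition has_dimension (W : set V) (d : nat) : Prop :=
  exists b : 'I_d -> V, lin_indep b /\ W = lin_span (range b).

(* [V] may be infinite-dimensional, so this is not [\dim] of the [vector]
   library; the value is the junk 0 if [W] has no finite basis. *)
Definition dimension (W : set V) : nat := xget 0%N [set d | has_dimension W d].

End Dimension.

Variable B : algType F.

(* The empty product 1 is included, as is usual for a unital algebra. *)
Definition growth_space (s : seq B) (n : nat) : set B :=
  lin_span [set p | exists w : seq B,
    [/\ (size w <= n)%N, {subset w <= s} & p = \prod_(x <- w) x]].

(* [ln d / ln n] is the logarithm of [d] in base [n]; the terms n = 0, 1, where
   it is meaningless, do not affect the upper limit. *)
Definition GKdim (R : realType) (s : seq B) : \bar R :=
  limn_esup (fun n : nat =>
    (ln (dimension (growth_space s n))%:R / ln n%:R)%:E).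

End GKDimension.

Section SymmetricSum.
Variables (F : fieldType) (B : algType F).

Definition jordan_mul (u v : B) : B := 2%:R^-1 *: (u * v + v * u).

Definition symmetric_sum (x y z : B) : B :=
  x * jordan_mul y z + y * jordan_mul z x + z * jordan_mul x y.

End SymmetricSum.

Section OffDiagonal.
Variable F : fieldType.

Definition zero_diag : {pred 'M[F]_2} := fun M => [forall i, M i i == 0].

Lemma zero_diagP (M : 'M[F]_2) :
  reflect (forall i, M i i = 0) (M \in zero_diag).
Proof. exact: 'forall_eqP. Qed.

Fact zero_diag_submod : submod_closed zero_diag.
Proof.
split; first by apply/zero_diagP => i; rewrite mxE.
move=> c M N /zero_diagP M0 /zero_diagP N0; apply/zero_diagP => i.
by rewrite !mxE M0 N0 mulr0 addr0.
Qed.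
HB.instance Definition _ :=
  GRing.isSubmodClosed.Build F 'M[F]_2 zero_diag zero_diag_submod.

Record offdiag := Offdiag { offdiag_val :> 'M[F]_2;
                            _ : offdiag_val \in zero_diag }.
HB.instance Definition _ := [isSub for offdiag_val].
HB.instance Definition _ := [Choice of offdiag by <:].
HB.instance Definition _ := [SubChoice_isSubLmodule of offdiag by <:].

Lemma zero_diag_mul3 (M N P : 'M[F]_2) :
  M \in zero_diag -> N \in zero_diag -> P \in zero_diag ->
  M * N * P \in zero_diag.
Proof.
move=> /zero_diagP M0 /zero_diagP N0 /zero_diagP P0; apply/zero_diagP => i.
rewrite -mulmxE mxE big1 // => j _; rewrite mxE.
have [->|ij] := eqVneq j i; first by rewrite P0 mulr0.
rewrite big1 ?mul0r // => k _.
have [->|ki] := eqVneq k i; first by rewrite M0 mul0r.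
suff -> : k = j by rewrite N0 mulr0.
by apply/eqP; move: i j k ij ki; do 3!case=> [[|[|?]] ?] //.
Qed.

Lemma symmetric_sum_zero_diag (x y z : offdiag) :
  symmetric_sum (x : 'M[F]_2) y z \in zero_diag.
Proof.
have V0 (u : offdiag) : val u \in zero_diag by exact: valP.
have H3 (u v w : offdiag) : val u * jordan_mul (val v) (val w) \in zero_diag.
  by rewrite /jordan_mul -scalerAr mulrDr !mulrA rpredZ // rpredD //;
     exact: zero_diag_mul3.
by rewrite /symmetric_sum !rpredD.
Qed.

Definition omega (x y z : offdiag) : offdiag :=
  Offdiag (symmetric_sum_zero_diag x y z).

Fact e1_subproof : delta_mx 0 1 \in zero_diag.
Proof. by apply/zero_diagP => -[[|[|?]] ?] //; rewrite mxE. Qed.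
Definition e1 : offdiag := Offdiag e1_subproof.

Fact e2_subproof : delta_mx 1 0 \in zero_diag.
Proof. by apply/zero_diagP => -[[|[|?]] ?] //; rewrite mxE. Qed.
Definition e2 : offdiag := Offdiag e2_subproof.

Lemma offdiagE (x : offdiag) : x = x 0 1 *: e1 + x 1 0 *: e2.
Proof.
apply/val_inj/matrixP => i j; have /zero_diagP x0 := valP x.
have I2 (k : 'I_2) : k = 0 \/ k = 1.
  by case: k => [[|[|?]] ?] //; [left|right]; exact: val_inj.
by case: (I2 i) => ->; case: (I2 j) => ->;
  rewrite !mxE ?x0 /= !(mulr1, mulr0, addr0, add0r).
Qed.

End OffDiagonal.

Arguments e1 {F}.
Arguments e2 {F}.

(* The free algebra is the monoid algebra of the free monoid on two letters,
   wrapped in a record with locked operations because those of [malg] make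
   conversion blow up when unfolded. [free_val] is an algebra isomorphism. *)
Record free_alg (F : fieldType) :=
  FreeAlg { free_val : malg (fmonom 'I_2) F }.

Section FreeAlgebra.
Variable F : fieldType.
Local Notation FA := (free_alg F).
Local Notation fval := (@free_val F).

HB.instance Definition _ := [isNew for fval].
HB.instance Definition _ := [Choice of FA by <:].

Lemma free_val_inj : injective fval. Proof. exact: val_inj. Qed.

Definition free_zero : FA := locked (FreeAlg 0).
Definition free_one : FA := locked (FreeAlg 1).
Definition free_add : FA -> FA -> FA :=
  locked (fun x y => FreeAlg (fval x + fval y)).
Definition free_opp : FA -> FA := locked (fun x => FreeAlg (- fval x)).
Definition free_mul : FA -> FA -> FA :=
  locked (fun x y => FreeAlg (fval x * fval y)).
Definition free_scale : F -> FA -> FA :=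
  locked (fun c x => FreeAlg (c *: fval x)).

Fact fval0 : fval free_zero = 0.
Proof. by rewrite /free_zero -lock. Qed.
Fact fval1 : fval free_one = 1.
Proof. by rewrite /free_one -lock. Qed.
Fact fvalD x y : fval (free_add x y) = fval x + fval y.
Proof. by rewrite /free_add -lock. Qed.
Fact fvalN x : fval (free_opp x) = - fval x.
Proof. by rewrite /free_opp -lock. Qed.
Fact fvalM x y : fval (free_mul x y) = fval x * fval y.
Proof. by rewrite /free_mul -lock. Qed.
Fact fvalZ c x : fval (free_scale c x) = c *: fval x.
Proof. by rewrite /free_scale -lock. Qed.

Fact free_addA : associative free_add.
Proof. by move=> x y z; apply: free_val_inj; rewrite !fvalD addrA. Qed.
Fact free_addC : commutative free_add.
Proof. by move=> x y; apply: free_val_inj; rewrite !fvalD addrC. Qed.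
Fact free_add0 : left_id free_zero free_add.
Proof. by move=> x; apply: free_val_inj; rewrite fvalD fval0 add0r. Qed.
Fact free_addN : left_inverse free_zero free_opp free_add.
Proof.
by move=> x; apply: free_val_inj; rewrite fvalD fvalN fval0 addNr.
Qed.
HB.instance Definition _ :=
  GRing.isZmodule.Build FA free_addA free_addC free_add0 free_addN.

Fact free_mulA : associative free_mul.
Proof. by move=> x y z; apply: free_val_inj; rewrite !fvalM mulrA. Qed.
Fact free_mul1 : left_id free_one free_mul.
Proof. by move=> x; apply: free_val_inj; rewrite fvalM fval1 mul1r. Qed.
Fact free_mulr1 : right_id free_one free_mul.
Proof. by move=> x; apply: free_val_inj; rewrite fvalM fval1 mulr1. Qed.
Fact free_mulDl : left_distributive free_mul free_add.
Proof.
by move=> x y z; apply: free_val_inj; rewrite !(fvalM, fvalD) mulrDl.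
Qed.
Fact free_mulDr : right_distributive free_mul free_add.
Proof.
by move=> x y z; apply: free_val_inj; rewrite !(fvalM, fvalD) mulrDr.
Qed.
Fact free_1neq0 : free_one != free_zero.
Proof.
apply/eqP => /(congr1 fval); rewrite fval0 fval1.
by apply/eqP; exact: oner_neq0.
Qed.
HB.instance Definition _ := GRing.Zmodule_isNzRing.Build FA
  free_mulA free_mul1 free_mulr1 free_mulDl free_mulDr free_1neq0.

Fact free_scaleA a b x : free_scale a (free_scale b x) = free_scale (a * b) x.
Proof. by apply: free_val_inj; rewrite !fvalZ scalerA. Qed.
Fact free_scale1 : left_id 1 free_scale.
Proof. by move=> x; apply: free_val_inj; rewrite fvalZ scale1r. Qed.
Fact free_scaleDr : right_distributive free_scale free_add.
Proof.
by move=> a x y; apply: free_val_inj; rewrite !(fvalZ, fvalD) scalerDr.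
Qed.
Fact free_scaleDl x a b :
  free_scale (a + b) x = free_add (free_scale a x) (free_scale b x).
Proof. by apply: free_val_inj; rewrite !(fvalZ, fvalD) scalerDl. Qed.
HB.instance Definition _ := GRing.Zmodule_isLmodule.Build F FA
  free_scaleA free_scale1 free_scaleDr free_scaleDl.

Fact free_scaleAl (k : F) (x y : FA) : k *: (x * y) = (k *: x) * y.
Proof.
change (free_scale k (free_mul x y) = free_mul (free_scale k x) y).
by apply: free_val_inj; rewrite !(fvalZ, fvalM) scalerAl.
Qed.
HB.instance Definition _ := GRing.Lmodule_isLalgebra.Build F FA free_scaleAl.

Fact malg_scaleAr (k : F) (x y : malg (fmonom 'I_2) F) :
  k *: (x * y) = x * (k *: y).
Proof.
have cen : x * mkmalgU mone k = mkmalgU mone k * x.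
  rewrite malgM_def fgmulgU mul_malgC malgZ_def.
  by apply: eq_bigr => i _; rewrite mulm1 mulrC.
by rewrite -!mul_malgC !mulrA cen.
Qed.
Fact free_scaleAr (k : F) (x y : FA) : k *: (x * y) = x * (k *: y).
Proof.
change (free_scale k (free_mul x y) = free_mul x (free_scale k y)).
apply: free_val_inj; rewrite (fvalZ k) !fvalM fvalZ; exact: malg_scaleAr.
Qed.
HB.instance Definition _ := GRing.Lalgebra_isAlgebra.Build F FA free_scaleAr.

Fact free_val_zmod_morphism : zmod_morphism fval.
Proof. by move=> x y; rewrite -fvalN -fvalD. Qed.
HB.instance Definition _ :=
  GRing.isZmodMorphism.Build FA (malg (fmonom 'I_2) F) fval
    free_val_zmod_morphism.

Fact free_val_monoid_morphism : monoid_morphism fval.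
Proof. by split=> [|x y]; [exact: fval1 | exact: fvalM]. Qed.
HB.instance Definition _ :=
  GRing.isMonoidMorphism.Build FA (malg (fmonom 'I_2) F) fval
    free_val_monoid_morphism.

Fact free_val_scalable : scalable fval.
Proof. exact: fvalZ. Qed.
HB.instance Definition _ :=
  GRing.isScalable.Build F FA (malg (fmonom 'I_2) F) *:%R fval
    free_val_scalable.

End FreeAlgebra.

Section Generators.
Variable F : fieldType.

Definition gen_a : free_alg F := FreeAlg (mkmalgU (fmu 0) 1).
Definition gen_b : free_alg F := FreeAlg (mkmalgU (fmu 1) 1).

Definition phi (x : offdiag F) : free_alg F :=
  x 0 1 *: gen_a + x 1 0 *: gen_b.

Fact phi_is_linear : linear phi.
Proof.
move=> c x y; rewrite /phi.
have xyE i j : (c *: x + y : offdiag F) i j = c * x i j + y i j.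
  have -> : offdiag_val (c *: x + y) = c *: offdiag_val x + offdiag_val y.
    exact: (linearP (val : offdiag F -> 'M[F]_2)).
  by rewrite !mxE.
rewrite (xyE 0 1) (xyE 1 0).
move: (offdiag_val x 0 1) (offdiag_val x 1 0) => x1 x2.
move: (offdiag_val y 0 1) (offdiag_val y 1 0) gen_a gen_b => y1 y2 a b.
by rewrite !scalerDl scalerDr !scalerA addrACA.
Qed.
HB.instance Definition _ :=
  GRing.isLinear.Build F (offdiag F) (free_alg F) _ phi phi_is_linear.

Lemma phi_e1 : phi e1 = gen_a.
Proof. by rewrite /phi !mxE /= scale1r scale0r addr0. Qed.

Lemma phi_e2 : phi e2 = gen_b.
Proof. by rewrite /phi !mxE /= scale1r scale0r add0r. Qed.

End Generators.

Definition gen_ideal (B : nzRingType) (X : set B) : set B :=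
  [set p | exists n (u g v : 'I_n -> B),
     (forall i, X (g i)) /\ p = \sum_i u i * g i * v i].

Section Envelope.
Variable F : fieldType.

Definition env_relators : set (free_alg F) :=
  [set r | exists x y z : offdiag F,
     [/\ x \in [:: e1; e2], y \in [:: e1; e2], z \in [:: e1; e2] &
         r = symmetric_sum (phi x) (phi y) (phi z) - phi (omega x y z)]].

Definition env_ideal : {pred free_alg F} :=
  fun p => `[< gen_ideal env_relators p >].

Lemma env_idealP p : reflect (gen_ideal env_relators p) (p \in env_ideal).
Proof. exact: asboolP. Qed.

Fact env_ideal_zmod : zmod_closed env_ideal.
Proof.
split.
  apply/env_idealP; exists 0%N, (fun=> 0), (fun=> 0), (fun=> 0).
  by split=> [[]//|]; rewrite big_ord0.
move=> p q /env_idealP[m [u [g [v [Xg ->]]]]].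
move=> /env_idealP[n [u' [g' [v' [Xg' ->]]]]]; apply/env_idealP.
pose cat T (f : 'I_m -> T) (f' : 'I_n -> T) (i : 'I_(m + n)) :=
  match fintype.split i with inl j => f j | inr j => f' j end.
exists (m + n)%N, (cat _ u (fun i => - u' i)), (cat _ g g'), (cat _ v v').
split=> [i|]; first by rewrite /cat; case: fintype.split.
rewrite big_split_ord /= -sumrN.
congr (_ + _); apply: eq_bigr => i _; rewrite /cat.
  by rewrite (unsplitK (inl i)).
by rewrite (unsplitK (inr i)) !mulNr.
Qed.
HB.instance Definition _ :=
  GRing.isZmodClosed.Build (free_alg F) env_ideal env_ideal_zmod.

Lemma env_idealMl a p : p \in env_ideal -> a * p \in env_ideal.
Proof.
move=> /env_idealP[n [u [g [v [Xg ->]]]]]; apply/env_idealP.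
exists n, (fun i => a * u i), g, v; split=> //.
by rewrite mulr_sumr; apply: eq_bigr => i _; rewrite !mulrA.
Qed.

Lemma env_idealMr a p : p \in env_ideal -> p * a \in env_ideal.
Proof.
move=> /env_idealP[n [u [g [v [Xg ->]]]]]; apply/env_idealP.
exists n, u, g, (fun i => v i * a); split=> //.
by rewrite mulr_suml; apply: eq_bigr => i _; rewrite !mulrA.
Qed.

(* The relators have no constant term, so the ideal is proper. *)
Lemma env_ideal1 : 1 \notin env_ideal.
Proof.
pose ev : free_alg F -> F := @mcoeff (fmonom 'I_2) F mone \o @free_val F.
have evD p q : ev (p + q) = ev p + ev q by rewrite /ev /= !raddfD.
have evB p q : ev (p - q) = ev p - ev q by rewrite /ev /= !raddfB.
have evM p q : ev (p * q) = ev p * ev q by rewrite /ev /= !rmorphM.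
have evZ c p : ev (c *: p) = c * ev p by rewrite /ev /= linearZ /= mcoeffZ.
have ev_gen i : ev (FreeAlg (mkmalgU (fmu i) 1)) = 0.
  rewrite /ev /= mcoeffU; case: eqP => //.
  by move/(congr1 (@fdeg _)); rewrite fdegU fdeg1.
have phi0 x : ev (phi x) = 0 by rewrite /phi evD !evZ !ev_gen !mulr0 addr0.
apply/env_idealP => -[n [u [g [v [Xg]]]]] /(congr1 ev).
have -> : ev 1 = 1 by rewrite /ev /= !rmorph1.
have -> : ev (\sum_i u i * g i * v i) = \sum_i ev (u i * g i * v i).
  by rewrite /ev /= !raddf_sum.
rewrite big1 => [/eqP|i _]; first by rewrite oner_eq0.
rewrite !evM; have [x [y [z [_ _ _ ->]]]] := Xg i.
rewrite evB phi0 subr0 /symmetric_sum !evD !evM !phi0.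
by rewrite !mul0r !addr0 mulr0 mul0r.
Qed.

Definition envelope : Type := {ideal_quot env_ideal}.

HB.instance Definition _ := GRing.Zmodule.on envelope.

Definition env_pi (p : free_alg F) : envelope := \pi_{ideal_quot env_ideal} p.

Lemma env_pi_eq p q : (env_pi p = env_pi q) <-> p - q \in env_ideal.
Proof.
rewrite /env_pi; split=> [/eqP|pq]; last apply/eqP.
  by rewrite -Quotient.idealrBE.
by rewrite -Quotient.idealrBE.
Qed.

Lemma env_piK (x : envelope) : env_pi (repr x) = x.
Proof. exact: reprK. Qed.

Lemma env_piD : {morph env_pi : p q / p + q}.
Proof. exact: raddfD. Qed.

Definition env_one : envelope := env_pi 1.
Definition env_mul (x y : envelope) : envelope := env_pi (repr x * repr y).
Definition env_scale (c : F) (x : envelope) : envelope := env_pi (c *: repr x).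

Lemma env_pi_mul p q : env_mul (env_pi p) (env_pi q) = env_pi (p * q).
Proof.
have rE r : repr (env_pi r) - r \in env_ideal.
  by apply/env_pi_eq; rewrite env_piK.
apply/env_pi_eq.
have -> : repr (env_pi p) * repr (env_pi q) - p * q =
    (repr (env_pi p) - p) * repr (env_pi q) + p * (repr (env_pi q) - q).
  by rewrite mulrBl mulrBr addrA subrK.
by apply: rpredD; [exact: env_idealMr | exact: env_idealMl].
Qed.

Lemma env_pi_scale c p : env_scale c (env_pi p) = env_pi (c *: p).
Proof.
apply/env_pi_eq; rewrite -scalerBr -[_ - _]mul1r scalerAl env_idealMl //.
by apply/env_pi_eq; rewrite env_piK.
Qed.

Fact env_mulA : associative env_mul.
Proof.
by move=> x y z; rewrite -[x]env_piK -[y]env_piK -[z]env_piK !env_pi_mul mulrA.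
Qed.
Fact env_mul1 : left_id env_one env_mul.
Proof. by move=> x; rewrite -[x]env_piK env_pi_mul mul1r. Qed.
Fact env_mulr1 : right_id env_one env_mul.
Proof. by move=> x; rewrite -[x]env_piK env_pi_mul mulr1. Qed.
Fact env_mulDl : left_distributive env_mul +%R.
Proof.
move=> x y z; rewrite -[x]env_piK -[y]env_piK -[z]env_piK.
by rewrite -env_piD !env_pi_mul mulrDl env_piD.
Qed.
Fact env_mulDr : right_distributive env_mul +%R.
Proof.
move=> x y z; rewrite -[x]env_piK -[y]env_piK -[z]env_piK.
by rewrite -env_piD !env_pi_mul mulrDr env_piD.
Qed.
Fact env_one_neq0 : env_one != 0.
Proof.
have <- : env_pi 0 = 0 by exact: raddf0.
by apply/eqP => /env_pi_eq; rewrite subr0; apply/negP/env_ideal1.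
Qed.
HB.instance Definition _ := GRing.Zmodule_isNzRing.Build envelope
  env_mulA env_mul1 env_mulr1 env_mulDl env_mulDr env_one_neq0.

Fact env_scaleA a b x : env_scale a (env_scale b x) = env_scale (a * b) x.
Proof. by rewrite -[x]env_piK !env_pi_scale scalerA. Qed.
Fact env_scale1 : left_id 1 env_scale.
Proof. by move=> x; rewrite -[x]env_piK env_pi_scale scale1r. Qed.
Fact env_scaleDr : right_distributive env_scale +%R.
Proof.
move=> a x y; rewrite -[x]env_piK -[y]env_piK.
by rewrite -env_piD !env_pi_scale scalerDr env_piD.
Qed.
Fact env_scaleDl x : {morph env_scale^~ x : a b / a + b}.
Proof.
by move=> a b; rewrite -[x]env_piK !env_pi_scale scalerDl env_piD.
Qed.
HB.instance Definition _ := GRing.Zmodule_isLmodule.Build F envelope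
  env_scaleA env_scale1 env_scaleDr env_scaleDl.

Fact env_scaleAl (a : F) (x y : envelope) : a *: (x * y) = (a *: x) * y.
Proof.
rewrite -[x]env_piK -[y]env_piK.
by rewrite [LHS](congr1 (env_scale a) (env_pi_mul _ _)) [a *: _]env_pi_scale
   [RHS]env_pi_mul env_pi_scale scalerAl.
Qed.
HB.instance Definition _ :=
  GRing.Lmodule_isLalgebra.Build F envelope env_scaleAl.

Fact env_scaleAr (a : F) (x y : envelope) : a *: (x * y) = x * (a *: y).
Proof.
rewrite -[x]env_piK -[y]env_piK.
by rewrite [LHS](congr1 (env_scale a) (env_pi_mul _ _)) [a *: _]env_pi_scale
   [RHS]env_pi_mul env_pi_scale scalerAr.
Qed.
HB.instance Definition _ :=
  GRing.Lalgebra_isAlgebra.Build F envelope env_scaleAr.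

Fact env_pi_zmod_morphism : zmod_morphism env_pi.
Proof. exact: raddfB. Qed.
HB.instance Definition _ :=
  GRing.isZmodMorphism.Build (free_alg F) envelope env_pi env_pi_zmod_morphism.

Fact env_pi_monoid_morphism : monoid_morphism env_pi.
Proof. by split=> // p q; rewrite -env_pi_mul. Qed.
HB.instance Definition _ := GRing.isMonoidMorphism.Build
  (free_alg F) envelope env_pi env_pi_monoid_morphism.

Fact env_pi_scalable : scalable env_pi.
Proof. by move=> a p; rewrite -env_pi_scale. Qed.
HB.instance Definition _ := GRing.isScalable.Build
  F (free_alg F) envelope *:%R env_pi env_pi_scalable.

Definition env_gens : seq envelope := [:: env_pi (gen_a F); env_pi (gen_b F)].

End Envelope.

(* Main.v *)
From HB Require Import structures.
Require Import Defs.
From mathcomp Require Import all_boot all_order all_algebra.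
From mathcomp Require Import -(notations) monalg.
From mathcomp Require Import ring.
From mathcomp Require Import all_classical all_reals all_analysis.

(* In characteristic 0 the relations of the envelope amount to a^3 = b^3 = 0,
   aab + aba + baa = a and bba + bab + abb = b.  With x = ba they give
   b x^(k+1) = (1 - x)^(k+1) b - a x^k b^2, so that the words a^i x^k b^j with
   i, j < 3 span the envelope; left multiplication by a or b raises k by at
   most 1, whence dim V^(n) <= 9 (n + 1).  Conversely, for every s in F there
   is a 3-dimensional representation in which x acts as diag(0, s, 1 - s);
   since F is infinite, the powers of x are linearly independent, and
   dim V^(n) > floor(n / 2). *)

Set Implicit Arguments.
Unset Strict Implicit.
Unset Printing Implicit Defensive.

Import Order.TTheory GRing.Theory Num.Theory numFieldNormedType.Exports.
Local Open Scope classical_set_scope.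
Local Open Scope ring_scope.

(** * Spans and dimension in a possibly infinite-dimensional space *)

Section LinSpan.
Variables (F : fieldType) (V : lmodType F).
Implicit Types (X : set V) (u v : V).

Lemma lin_span_ind X (P : set V) :
    P 0 -> (forall u v, P u -> P v -> P (u + v)) ->
    (forall c v, P v -> P (c *: v)) -> X `<=` P ->
  lin_span X `<=` P.
Proof.
move=> P0 PD PZ XP _ [n [c [x [Xx ->]]]].
by elim/big_ind: _ => // i _; exact/PZ/XP.
Qed.

Lemma lin_span_incl X : X `<=` lin_span X.
Proof.
move=> v Xv; exists 1%N, (fun=> 1), (fun=> v).
by split=> //; rewrite big_ord1 scale1r.
Qed.

Lemma lin_span0 X : lin_span X 0.
Proof.
by exists 0%N, (fun=> 0), (fun=> 0); split=> [[]//|]; rewrite big_ord0.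
Qed.

Lemma lin_spanD X u v : lin_span X u -> lin_span X v -> lin_span X (u + v).
Proof.
move=> [m [c [x [Xx ->]]]] [n [d [y [Xy ->]]]].
pose cat T (f : 'I_m -> T) (g : 'I_n -> T) (i : 'I_(m + n)) :=
  match fintype.split i with inl j => f j | inr j => g j end.
exists (m + n)%N, (cat _ c d), (cat _ x y).
split=> [i|]; first by rewrite /cat; case: fintype.split.
by rewrite big_split_ord /=; congr (_ + _); apply: eq_bigr => i _; rewrite /cat;
   [rewrite (unsplitK (inl i)) | rewrite (unsplitK (inr i))].
Qed.

Lemma lin_spanZ X c v : lin_span X v -> lin_span X (c *: v).
Proof.
move=> [n [d [x [Xx ->]]]]; exists n, (fun i => c * d i), x; split=> //.
by rewrite scaler_sumr; apply: eq_bigr => i _; rewrite scalerA.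
Qed.

Lemma lin_spanB X u v : lin_span X u -> lin_span X v -> lin_span X (u - v).
Proof.
by move=> Xu Xv; rewrite -scaleN1r; apply/lin_spanD/lin_spanZ.
Qed.

Lemma lin_span_min X Y : X `<=` lin_span Y -> lin_span X `<=` lin_span Y.
Proof.
by apply: lin_span_ind; [exact: lin_span0|exact: lin_spanD|exact: lin_spanZ].
Qed.

Lemma lin_span_rangeP (I : finType) (b : I -> V) v :
  lin_span (range b) v -> exists c : I -> F, v = \sum_i c i *: b i.
Proof.
apply: (@lin_span_ind _ [set v | exists c : I -> F, v = \sum_i c i *: b i]) =>
  [|_ _ [c ->] [d ->]|c _ [d ->]|_ [i _ <-]].
- by exists (fun=> 0); rewrite big1 // => i _; rewrite scale0r.
- exists (fun i => c i + d i); rewrite -big_split /=.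
  by apply: eq_bigr => i _; rewrite scalerDl.
- exists (fun i => c * d i); rewrite scaler_sumr.
  by apply: eq_bigr => i _; rewrite scalerA.
- exists (fun j => (j == i)%:R); rewrite (bigD1 i) //= eqxx scale1r.
  rewrite big1 ?addr0 //.
  by move=> j /negbTE ->; rewrite scale0r.
Qed.

(** If [d] exceeded [#|I|], the matrix [C] of coordinates would have a nonzero row vector in its
    left kernel, which is a dependence among the [e i]. The family [b] itself may be dependent. *)
Lemma lin_indep_leq (I : finType) (b : I -> V) d (e : 'I_d -> V) :
  lin_indep e -> (forall i, lin_span (range b) (e i)) -> (d <= #|I|)%N.
Proof.
move=> e_free eb.
have /boolp.choice[c ce] : forall i, exists ci : I -> F,
    e i = \sum_j ci j *: b j.
  by move=> i; exact/lin_span_rangeP.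
rewrite leqNgt; apply/negP => ltId.
pose C : 'M[F]_(d, #|I|) := \matrix_(i, j) c i (enum_val j).
have : kermx C != 0.
  by rewrite kermx_eq0 -row_leq_rank -ltnNge (leq_ltn_trans (rank_leq_col C)).
case/rowV0Pn => u /sub_kermxP uC0 /eqP[]; apply/rowP => i.
rewrite mxE; apply: (e_free (u 0)) i.
transitivity (\sum_(t : I) (\sum_i u 0 i * c i t) *: b t).
  under eq_bigr do rewrite ce scaler_sumr.
  rewrite exchange_big /=; apply: eq_bigr => t _; rewrite scaler_suml.
  by apply: eq_bigr => i _; rewrite scalerA.
apply: big1 => t _; move/rowP/(_ (enum_rank t)): uC0; rewrite !mxE => uCt.
rewrite -[RHS](scale0r (b t)) -[in RHS]uCt; congr (_ *: _).
by apply: eq_bigr => i _; rewrite mxE enum_rankK.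
Qed.

(** Independent families in the span have at most [#|I|] members, so one of maximal size exists; it
    spans, since a vector outside its span would extend it. *)
Lemma lin_span_has_dimension (I : finType) (b : I -> V) X :
  lin_span X `<=` lin_span (range b) -> exists d, has_dimension (lin_span X) d.
Proof.
move=> Xb.
pose P d := `[< exists e : 'I_d -> V, lin_indep e /\ range e `<=` lin_span X >].
have exP : exists d, P d.
  exists 0%N; apply/asboolP; exists (fun=> 0).
  by split=> [c _ []//|_ [[]]//].
have ubP d : P d -> (d <= #|I|)%N.
  move=> /asboolP[e [e_free eX]]; apply: (lin_indep_leq e_free) => i.
  by apply/Xb/eX; exists i.
have [d /asboolP[e [e_free eX]] d_max] := ex_maxnP exP ubP.
exists d, e; split=> //; apply/seteqP; split; last exact: lin_span_min.
move=> v Xv; apply: contrapT => nev.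
suff /d_max : P d.+1 by rewrite ltnn.
apply/asboolP; exists (fun i => if unlift ord0 i is Some j then e j else v).
split=> [c|_ [i _ <-]]; last first.
  by case: (unlift _ _) => [j|//]; apply: eX; exists j.
rewrite big_ord_recl unlift_none.
under eq_bigr do rewrite liftK; move=> cv0.
have c0 : c ord0 = 0.
  apply/eqP/negP => /negP c0; apply: nev.
  have -> : v = - (c ord0)^-1 *: \sum_i c (lift ord0 i) *: e i.
    move/eqP: cv0; rewrite addrC addr_eq0 => /eqP ->.
    by rewrite scalerN scaleNr opprK scalerA mulVf // scale1r.
  apply: lin_spanZ; exists d, (fun i => c (lift ord0 i)), e.
  by split=> // i; exists i.
move: cv0; rewrite c0 scale0r add0r => /e_free ce i.
by case: (unliftP ord0 i) => [j|] ->.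
Qed.

(** The finite spanning family guarantees a basis, so [dimension] takes a genuine value here and not
    its default 0. *)
Lemma dimension_bounds (I : finType) (b : I -> V) X m (e : 'I_m -> V) :
    lin_span X `<=` lin_span (range b) ->
    lin_indep e -> (forall i, lin_span X (e i)) ->
  (m <= dimension (lin_span X) <= #|I|)%N.
Proof.
move=> Xb e_free eX; have [d Xd] := lin_span_has_dimension Xb.
have [f [f_free fX]] : has_dimension (lin_span X) (dimension (lin_span X)).
  exact: (xgetPex 0%N (ex_intro _ _ Xd)).
apply/andP; split; last first.
  apply: (lin_indep_leq f_free) => i; apply: Xb; rewrite [X in X _]fX.
  by apply: lin_span_incl; exists i.
rewrite -[X in (_ <= X)%N]card_ord.
by apply: (@lin_indep_leq _ f _ e e_free) => i; rewrite -fX.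
Qed.

End LinSpan.

(** * Straightening of words under the cubic relations, and bounds on the growth *)

Section NormalForms.
Variables (F : fieldType) (U : algType F) (a b : U).
Hypotheses (a3 : a ^+ 3 = 0) (b3 : b ^+ 3 = 0).
Hypothesis aab : a * a * b + a * b * a + b * a * a = a.
Hypothesis bba : b * b * a + b * a * b + a * b * b = b.

Local Notation x := (b * a).
Local Notation y := (1 - x).

Lemma mulb_x : b * x = y * b - a * b ^+ 2.
Proof.
by rewrite mulrBl mul1r -[X in X - _ * b]bba expr2 !mulrA addrAC !addrK.
Qed.

Lemma muly_a : y * a = a * x + a ^+ 2 * b.
Proof.
by rewrite mulrBl mul1r -{1}aab expr2 !mulrA addrK addrC.
Qed.

Lemma mulb_expx k : b * x ^+ k.+1 = y ^+ k.+1 * b - y ^+ k * a * b ^+ 2.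
Proof.
elim: k => [|k IHk]; first by rewrite !expr1 expr0 mul1r mulb_x.
rewrite exprSr mulrA IHk mulrBl.
(* Since [b ^+ 2 * x] is [b ^+ 3 * a], the correction term of the previous stage dies and only the
   newest one remains. *)
have -> : y ^+ k * a * b ^+ 2 * x = 0.
  by rewrite -mulrA [b ^+ 2 * _]mulrA -exprSr b3 mul0r mulr0.
by rewrite subr0 -[LHS]mulrA mulb_x mulrBr !mulrA -exprSr.
Qed.

(** After [mulb_expx], every term ends in at least three factors [b]. *)
Lemma mulb_expx_b2 k : b * x ^+ k * b ^+ 2 = 0.
Proof.
case: k => [|k]; first by rewrite expr0 mulr1 -exprS.
by rewrite mulb_expx mulrBl -!mulrA -exprS b3 !mulr0 subr0.
Qed.

(** Moving [y] past [a] by [muly_a] turns it into [x]; the extra term contains [b * x ^+ k * b ^+ 2]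
    and vanishes. *)
Lemma expy_a_b2 k : y ^+ k * a * b ^+ 2 = a * x ^+ k * b ^+ 2.
Proof.
elim: k => [|k IHk]; first by rewrite !expr0 mulr1 mul1r.
rewrite exprS -!mulrA (mulrA (y ^+ k)) IHk !mulrA muly_a !mulrDl.
have -> : a ^+ 2 * b * x ^+ k * b * b = 0.
  by rewrite -[LHS]mulrA -2!(mulrA (a ^+ 2)) mulb_expx_b2 mulr0.
by rewrite addr0 [in RHS]exprS !mulrA.
Qed.

(** Capping the exponent of [x] at [n] makes the index type finite, with 9 (n + 1) elements. *)
Definition normal_word n (t : 'I_3 * 'I_n.+1 * 'I_3) : U :=
  a ^+ t.1.1 * x ^+ t.1.2 * b ^+ t.2.

Definition normal_span n : set U := lin_span (range (@normal_word n)).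

Lemma normal_span_word n i k j : (k <= n)%N ->
  normal_span n (a ^+ i * x ^+ k * b ^+ j).
Proof.
move=> kn; have [i3|i3] := leqP 3 i.
  by rewrite -(subnK i3) exprD a3 mulr0 !mul0r; exact: lin_span0.
have [j3|j3] := leqP 3 j.
  by rewrite -(subnK j3) exprD b3 !mulr0; exact: lin_span0.
rewrite -ltnS in kn; apply: lin_span_incl.
by exists (Ordinal i3, Ordinal kn, Ordinal j3).
Qed.

Lemma normal_spanW m n : (m <= n)%N -> normal_span m `<=` normal_span n.
Proof.
move=> mn; apply: lin_span_min => _ [[[i k] j] _ <-].
by apply: normal_span_word; rewrite (leq_trans _ mn) // -ltnS.
Qed.

Lemma normal_span_mul c m n :
    (forall i k j, (k <= m)%N ->
      normal_span n (c * (a ^+ i * x ^+ k * b ^+ j))) ->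
  forall v, normal_span m v -> normal_span n (c * v).
Proof.
move=> cn; apply: (@lin_span_ind _ _ _ [set v | normal_span n (c * v)]) =>
  /= [|u v cu cv|d v cv|_ [[[i k] j] _ <-]].
- by rewrite mulr0; exact: lin_span0.
- by rewrite mulrDr; exact: lin_spanD.
- by rewrite -scalerAr; exact: lin_spanZ.
- by apply: cn; rewrite -ltnS.
Qed.

Lemma normal_span_mula n v : normal_span n v -> normal_span n (a * v).
Proof.
apply: normal_span_mul => i k j kn.
by rewrite !mulrA -exprS; exact: normal_span_word.
Qed.

(** Expanding one factor [y] gives y^(m+1) x^k = y^m x^k - y^m x^(k+1), where the total exponent
    does not grow. *)
Lemma normal_span_expy n m k j : (m + k <= n)%N ->
  normal_span n (y ^+ m * x ^+ k * b ^+ j).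
Proof.
elim: m k => [|m IHm] k.
  by move=> kn; rewrite expr0 -(expr0 a); exact: normal_span_word.
move=> mkn; rewrite exprSr -[y ^+ m * y * _]mulrA mulrBl mul1r -exprS.
rewrite mulrBr mulrBl; apply: lin_spanB; apply: IHm; last by rewrite addnS.
by rewrite ltnW.
Qed.

Lemma normal_span_b_expx n k j : (k <= n)%N ->
  normal_span n (b * x ^+ k * b ^+ j).
Proof.
case: k => [_|k kn].
  have := @normal_span_word n 0 0 j.+1 isT.
  by rewrite !expr0 !mulr1 mul1r -exprS.
rewrite mulb_expx expy_a_b2 mulrBl; apply: lin_spanB.
  have := @normal_span_expy n k.+1 0 j.+1; rewrite addn0 => /(_ kn).
  by rewrite expr0 mulr1 (exprS b) mulrA.
rewrite -(mulrA _ (b ^+ 2)) -exprD.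
exact: (@normal_span_word n 1 k (2 + j) (ltnW kn)).
Qed.

(** By the number of leading [a]: with none, [b] is straightened past the powers of [x]; one merges
    with [b] into a further [x]; for two, [aab] rewrites baa as a - aab - aba; three or more give
    0. *)
Lemma normal_span_mulb n v : normal_span n v -> normal_span n.+1 (b * v).
Proof.
apply: normal_span_mul => i k j kn; have kn1 := leqW kn.
case: i => [|[|[|i]]].
- by rewrite expr0 mul1r mulrA; exact: normal_span_b_expx.
- have := @normal_span_word n.+1 0 k.+1 j kn.
  by rewrite expr0 mul1r expr1 exprS !mulrA.
- have -> : b * (a ^+ 2 * x ^+ k * b ^+ j) =
      a * x ^+ k * b ^+ j - a * (a * (b * x ^+ k * b ^+ j)) -
      a * x ^+ k.+1 * b ^+ j.
    have baa : b * a * a = a - a * a * b - a * b * a.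
      by rewrite -[X in X - _ - _]aab -addrA -opprD addrC addKr.
    by rewrite !mulrA baa exprS !mulrBl !mulrA.
  apply: lin_spanB; first apply: lin_spanB.
  + exact: (@normal_span_word n.+1 1 k j kn1).
  + by do 2!apply: normal_span_mula; exact: normal_span_b_expx.
  + exact: (@normal_span_word n.+1 1 k.+1 j kn).
- by rewrite -(addn3 i) exprD a3 mulr0 !mul0r mulr0; exact: lin_span0.
Qed.

Lemma growth_space_sub n : growth_space [:: a; b] n `<=` normal_span n.
Proof.
apply: lin_span_min => _ [w [wn ws ->]].
apply: (@normal_spanW (size w)) => //; elim: w ws {wn} => [|c w IHw] ws.
  rewrite big_nil; have := @normal_span_word 0 0 0 0 isT.
  by rewrite !expr0 !mulr1.
rewrite big_cons; have {}IHw : normal_span (size w) (\prod_(j <- w) j).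
  by apply: IHw => d dw; apply: ws; rewrite inE dw orbT.
have := ws c (mem_head _ _); rewrite !inE => /orP[] /eqP ->.
  by apply: (@normal_spanW (size w)) => //; exact: normal_span_mula.
exact: normal_span_mulb.
Qed.

(** The witness is the word ba repeated [k] times, hence the length [k.*2]. *)
Lemma growth_space_expx n k : (k.*2 <= n)%N ->
  growth_space [:: a; b] n (x ^+ k).
Proof.
move=> kn; apply: lin_span_incl; exists (flatten (nseq k [:: b; a])); split.
- by rewrite size_flatten /shape map_nseq sumn_nseq /= mul2n.
- move=> c /flattenP[s]; rewrite mem_nseq => /andP[_ /eqP ->].
  by rewrite !inE orbC.
- by elim: k {kn} => [|k IHk]; rewrite /= ?big_nil// !big_cons -IHk exprS mulrA.
Qed.

Lemma growth_space_dimension n :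
    (forall m, lin_indep (fun i : 'I_m => x ^+ i)) ->
  (n./2.+1 <= dimension (growth_space [:: a; b] n) <= 9 * n.+1)%N.
Proof.
move=> x_free; have -> : (9 * n.+1 = #|{: 'I_3 * 'I_n.+1 * 'I_3}|)%N.
  by rewrite !card_prod !card_ord mulnAC.
apply: dimension_bounds (@growth_space_sub n) (x_free _) _ => i.
apply: growth_space_expx; rewrite -[leqRHS]odd_double_half.
by rewrite (leq_trans _ (leq_addl _ _)) // leq_double -ltnS.
Qed.

End NormalForms.

(** The universal property of the free algebra; it will turn a pair of matrices into a
    representation. *)
Lemma free_alg_lift (F : fieldType) (B : algType F) (c d : B) :
  exists f : {lrmorphism free_alg F -> B}, f (gen_a F) = c /\ f (gen_b F) = d.
Proof.
pose g (i : 'I_2) := if i == 0 then c else d.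
pose h (m : fmonom 'I_2) : B := \prod_(i <- m) g i.
have h_morph : mmorphism h.
  by split=> [m n|]; rewrite /h ?fmM ?fm1 ?big_cat ?big_nil.
pose hM : MMorphism.type _ _ :=
  HB.pack_for (MMorphism.type (fmonom 'I_2) B) h
    (isMultiplicative.Build _ _ _ h_morph).
pose f0 := mmap (in_alg B) hM.
pose f : free_alg F -> B := f0 \o @free_val F.
have [f01 f0M] : monoid_morphism f0.
  split; first exact: mmap1.
  (* Scalars are central, which is the commutation that makes [mmap] multiplicative. *)
  have comm (u : malg (fmonom 'I_2) F) (m m' : fmonom 'I_2) :
      GRing.comm (in_alg B (mcoeff m u)) (hM m').
    by rewrite /GRing.comm /= mulr_algl mulr_algr.
  exact: (commr_mmap_is_multiplicative comm).1.
have fB : zmod_morphism f.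
  by move=> p q; rewrite /f /= (raddfB (@free_val F)) [LHS]mmapB.
have fM : monoid_morphism f.
  by split=> [|p q]; rewrite /f /= ?rmorphM ?f0M// rmorph1.
have fZ : scalable f.
  by move=> k p; rewrite /f /= linearZ /= /f0 mmapZ /= mulr_algl.
pose fL : {lrmorphism free_alg F -> B} :=
  HB.pack f (GRing.isZmodMorphism.Build _ _ _ fB)
    (GRing.isMonoidMorphism.Build _ _ _ fM)
    (GRing.isScalable.Build _ _ _ _ _ fZ).
have fU i : fL (FreeAlg (mkmalgU (fmu i) 1)) = g i.
  by rewrite /= /f /= /f0 mmapU /= scale1r mul1r /h fmU big_seq1.
by exists fL; rewrite !fU.
Qed.

(** * Symmetric sums and the values of [omega] in characteristic 0 *)

Section SymmetricSums.
Variables (F : fieldType) (B : algType F).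
Hypothesis F_char0 : [pchar F] =i pred0.
Implicit Types x y z : B.

Lemma natS_neq0 n : n.+1%:R != 0 :> F.
Proof. by have /pcharf0P -> := F_char0. Qed.

Lemma symmetric_sumE x y z : symmetric_sum x y z =
  2%:R^-1 *: (x * y * z + x * z * y + y * z * x +
              y * x * z + z * x * y + z * y * x).
Proof.
by rewrite /symmetric_sum /jordan_mul -!scalerAr -!scalerDr !mulrDr !mulrA
  !addrA.
Qed.

Lemma symmetric_sum_rot x y z : symmetric_sum x y z = symmetric_sum y z x.
Proof. by rewrite /symmetric_sum -addrA addrC. Qed.

(** With a repeated argument the six products coincide in pairs, which cancels the factor 1/2. *)
Lemma symmetric_sum_pair x y :
  symmetric_sum x x y = x * x * y + x * y * x + y * x * x.
Proof.
rewrite symmetric_sumE; set p := x * x * y; set q := x * y * x; set r := _ * x.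
have -> : p + q + q + p + r + r = 2%:R *: (p + q + r).
  rewrite scaler_nat mulr2n [RHS]addrACA -!addrA; congr (_ + (_ + _)).
  by rewrite addrCA.
by rewrite scalerA mulVf ?scale1r ?natS_neq0.
Qed.

Lemma symmetric_sum_diag x : symmetric_sum x x x = 3%:R *: x ^+ 3.
Proof.
rewrite symmetric_sum_pair exprSr expr2 scaler_nat.
by rewrite !mulrS mulr0n addr0 addrA.
Qed.

End SymmetricSums.

Lemma symmetric_sum_morph (F : fieldType) (B C : algType F)
    (f : {lrmorphism B -> C}) x y z :
  f (symmetric_sum x y z) = symmetric_sum (f x) (f y) (f z).
Proof.
by rewrite /symmetric_sum /jordan_mul !rmorphD !rmorphM /= !linearZ /= !rmorphD
  !rmorphM.
Qed.

(** Reduces the eight triples of basis vectors to the four of [omega_table]. *)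
Lemma omega_rot (F : fieldType) (x y z : offdiag F) :
  omega x y z = omega y z x.
Proof. by apply: val_inj; rewrite /= symmetric_sum_rot. Qed.

(** As [e1] and [e2] square to 0, only the products e1 e2 e1 = e1 and e2 e1 e2 = e2 survive. *)
Lemma omega_table (F : fieldType) : [pchar F] =i pred0 ->
  [/\ omega e1 e1 e1 = 0 :> offdiag F, omega e2 e2 e2 = 0 :> offdiag F,
      omega e1 e1 e2 = e1 :> offdiag F & omega e2 e2 e1 = e2 :> offdiag F].
Proof.
move=> F0.
split; apply: val_inj;
  rewrite /= ?(symmetric_sum_diag F0, symmetric_sum_pair F0);
  rewrite ?exprS ?expr0 ?mulr1 -!mulmxE !mul_delta_mx_cond /= ?mulmx0 ?mul0mx;
  by rewrite ?mulr0n ?mulr1n ?mulmx0 ?mul0mx ?scaler0 ?add0r ?addr0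
    ?mul_delta_mx_cond.
Qed.

(** Supplies arbitrarily many distinct evaluation points in [F]. *)
Lemma natr_inj (F : fieldType) : [pchar F] =i pred0 ->
  injective (fun n : nat => n%:R : F).
Proof.
move=> /pcharf0P F0 m n; wlog le_nm : m n / (n <= m)%N => [IH|mn].
  by case: (leqP n m) => [/IH//|/ltnW/IH eq_nm /esym/eq_nm].
apply/eqP; rewrite eqn_leq le_nm andbT -subn_eq0 -F0 natrB // mn.
by rewrite subrr.
Qed.

(** * Three-dimensional representations of the cubic relations *)

Definition cubic_relations (B : nzRingType) (a b : B) : Prop :=
  [/\ a ^+ 3 = 0, b ^+ 3 = 0, a * a * b + a * b * a + b * a * a = a &
      b * b * a + b * a * b + a * b * b = b].

Definition raise_mx (F : fieldType) : 'M[F]_3 :=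
  \matrix_(i, j) (j == i.+1 :> nat)%:R.
(** The two weights below the diagonal must add up to 1 for aab + aba + baa = a to hold, which
    leaves one free parameter. *)
Definition lower_mx (F : fieldType) (s : F) : 'M[F]_3 :=
  \matrix_(i, j) ((i == j.+1 :> nat)%:R * (if j == 0 :> nat then s else 1 - s)).

(** The diagonal form lets a polynomial in ba be evaluated at [s] by reading off the middle
    entry. *)
Lemma lower_raise_mx (F : fieldType) (s : F) :
  lower_mx s * raise_mx F = diag_mx (\row_(i < 3) [:: 0; s; 1 - s]`_i).
Proof.
apply/matrixP => i j; rewrite -mulmxE !mxE !big_ord_recl big_ord0 !mxE.
case: i => [[|[|[|]]] ?] //; case: j => [[|[|[|]]] ?] //; rewrite /=; ring.
Qed.

Lemma expr_diag_mx (R : nzRingType) n (d : 'rV[R]_n.+1) k i :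
  (diag_mx d ^+ k) i i = d 0 i ^+ k.
Proof.
elim: k => [|k IHk]; first by rewrite !expr0 mxE eqxx.
by rewrite !exprS -mulmxE mul_diag_mx mxE IHk.
Qed.

Lemma raise_lower_cubic (F : fieldType) (s : F) :
  cubic_relations (raise_mx F) (lower_mx s).
Proof.
rewrite /cubic_relations !exprS !expr0 !mulr1.
split; apply/matrixP => i j; rewrite -!mulmxE;
 do ![rewrite mxE|rewrite big_ord_recl|rewrite big_ord0].
all: case: i => [[|[|[|]]] ?] //; case: j => [[|[|[|]]] ?] //; rewrite /=; ring.
Qed.

(** * The envelope: its relations and the independence of the powers of ba *)

Section Envelope.
Variable F : fieldType.
Hypothesis F_char0 : [pchar F] =i pred0.

Lemma env_cubic_relations :
  cubic_relations (env_pi (gen_a F)) (env_pi (gen_b F)).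
Proof.
have rel (x y z : offdiag F) : x \in [:: e1; e2] -> y \in [:: e1; e2] ->
    z \in [:: e1; e2] ->
    symmetric_sum (env_pi (phi x)) (env_pi (phi y)) (env_pi (phi z)) =
    env_pi (phi (omega x y z)).
  move=> xe ye ze; rewrite -symmetric_sum_morph; apply/env_pi_eq/env_idealP.
  exists 1%N, (fun=> 1), (fun=> symmetric_sum (phi x) (phi y) (phi z) -
    phi (omega x y z)), (fun=> 1).
  by split=> [_|]; [exists x, y, z | rewrite big_ord1 mul1r mulr1].
have [w1 w2 w3 w4] := omega_table F_char0.
have me1 : (e1 : offdiag F) \in [:: e1; e2] by rewrite mem_head.
have me2 : (e2 : offdiag F) \in [:: e1; e2] by rewrite !inE eqxx orbT.
(* The symmetric sum of three equal arguments is 3 times the cube, and 3 is invertible. *)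
have cube (u : envelope F) : symmetric_sum u u u = 0 -> u ^+ 3 = 0.
  move/eqP; rewrite symmetric_sum_diag // scaler_eq0.
  rewrite (negbTE (natS_neq0 F_char0 _)) //.
  by move/eqP.
split.
- by apply: cube; rewrite -phi_e1 rel // w1 linear0 raddf0.
- by apply: cube; rewrite -phi_e2 rel // w2 linear0 raddf0.
- by rewrite -symmetric_sum_pair // -phi_e1 -phi_e2 rel // w3.
- by rewrite -symmetric_sum_pair // -phi_e1 -phi_e2 rel // w4.
Qed.

(** Lets a pair satisfying the cubic relations act as a representation of the envelope: up to
    rotation, each relator comes from one of the four triples in [omega_table]. *)
Lemma env_ideal_lift (B : algType F) (f : {lrmorphism free_alg F -> B}) p :
  cubic_relations (f (gen_a F)) (f (gen_b F)) ->
  p \in env_ideal (F:=F) -> f p = 0.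
Proof.
move=> [a3 b3 aab bba] /env_idealP[n [u [g [v [Xg ->]]]]].
rewrite rmorph_sum /= big1 // => i _; rewrite !rmorphM /=.
suff -> : f (g i) = 0 by rewrite mulr0 mul0r.
have [x [y [z [xe ye ze ->]]]] := Xg i; rewrite raddfB /= symmetric_sum_morph.
apply/eqP; rewrite subr_eq0; apply/eqP.
have [w1 w2 w3 w4] := omega_table F_char0.
pose rel x y z :=
  symmetric_sum (f (phi x)) (f (phi y)) (f (phi z)) = f (phi (omega x y z)).
have rot x' y' z' : rel x' y' z' -> rel y' z' x'.
  by rewrite /rel symmetric_sum_rot (omega_rot x').
have r1 : rel e1 e1 e1.
  by rewrite /rel w1 phi_e1 symmetric_sum_diag // a3 scaler0 !linear0.
have r2 : rel e2 e2 e2.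
  by rewrite /rel w2 phi_e2 symmetric_sum_diag // b3 scaler0 !linear0.
have r3 : rel e1 e1 e2.
  by rewrite /rel w3 phi_e1 phi_e2 symmetric_sum_pair.
have r4 : rel e2 e2 e1.
  by rewrite /rel w4 phi_e1 phi_e2 symmetric_sum_pair.
rewrite -/(rel x y z).
move: xe ye ze; rewrite !inE => /orP[]/eqP-> /orP[]/eqP-> /orP[]/eqP->.
- exact: r1.
- exact: r3.
- exact: (rot _ _ _ r3).
- exact: (rot _ _ _ (rot _ _ _ r4)).
- exact: (rot _ _ _ (rot _ _ _ r3)).
- exact: (rot _ _ _ r4).
- exact: r4.
- exact: r2.
Qed.

(** A dependence is a polynomial [P] in ba that every representation kills; hence P(s) = 0 for every
    [s], and [P] is zero. *)
Lemma env_expx_indep m :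
  lin_indep (fun i : 'I_m => (env_pi (gen_b F) * env_pi (gen_a F)) ^+ i).
Proof.
move=> c c0.
have ideal_c : \sum_i c i *: (gen_b F * gen_a F) ^+ i \in env_ideal (F:=F).
  rewrite -[X in X \in _]subr0; apply/env_pi_eq.
  rewrite raddf0 -[RHS]c0 raddf_sum.
  by apply: eq_bigr => i _; rewrite /= [LHS]linearZ /= rmorphXn rmorphM.
(* [\poly] takes coefficients indexed by naturals, so [c] is extended by the default 0. *)
pose cs := [seq c i | i <- enum 'I_m]; pose P := \poly_(i < m) cs`_i.
have csE (i : 'I_m) : cs`_i = c i.
  by rewrite (nth_map i) ?size_enum_ord // nth_ord_enum.
have rootP s : root P s.
  have [f [fa fb]] := free_alg_lift (raise_mx F) (lower_mx s).
  have := env_ideal_lift (f := f) _ ideal_c.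
  rewrite fa fb => /(_ (raise_lower_cubic s)); rewrite rmorph_sum /=.
  under eq_bigr do rewrite linearZ /= rmorphXn rmorphM /= fa fb lower_raise_mx.
  (* The middle diagonal entry of the i-th power of ba is s^i. *)
  move=> /matrixP/(_ 1 1); rewrite mxE summxE => sum0.
  apply/rootP; rewrite horner_poly -[RHS]sum0; apply: eq_bigr => i _.
  by rewrite csE mxE expr_diag_mx mxE.
suff P0 : P = 0.
  move=> i; have := congr1 (fun p : {poly F} => p`_i) P0.
  by rewrite coef_poly ltn_ord csE coef0.
apply/eqP/negP => /negP P0.
(* The images of 0, ..., m - 1 are m distinct roots, but a nonzero [P] has degree below m. *)
pose rs : seq F := [seq k%:R | k <- iota 0 m].
have := max_poly_roots (rs := rs) P0.
have -> : all (root P) rs by apply/allP.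
have -> : uniq rs.
  rewrite map_inj_uniq ?iota_uniq // => k l; exact: natr_inj.
rewrite size_map size_iota => /(_ isT isT).
by rewrite ltnNge size_poly.
Qed.

End Envelope.

(** * Logarithmic growth rate of linearly bounded sequences *)

Lemma cvg_div_ln_nat (R : realType) (C : R) :
  C / ln n%:R @[n --> \oo] --> 0.
Proof.
rewrite -(mulr0 C); apply: cvgMr.
have ln_gt A : \forall n \near \oo, A < ln n%:R :> R.
  near=> n; have An : expR A < n%:R :> R by near: n; exact: nbhs_infty_gtr.
  by rewrite -ltr_expR lnK // posrE (lt_trans (expR_gt0 _) An).
by apply/gtr0_cvgV0; [exact: ln_gt | exact/cvgryPgt].
Unshelve. all: by end_near. Qed.

(** The ratio is squeezed between 1 - ln p / ln n and 1 + ln (2q) / ln n; the factor 2 absorbs n + 1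
    <= 2n. *)
Lemma ln_linear_growth_cvg (R : realType) (d : nat -> nat) (p q : nat) :
    (forall n, (n <= p * d n)%N && (d n <= q * n.+1)%N) ->
  ln (d n)%:R / ln n%:R @[n --> \oo] --> (1 : R).
Proof.
move=> pdq.
have := @squeeze_cvgr _ \oo _ R (fun n => 1 - ln p%:R / ln n%:R)
  (fun n => 1 + ln (2 * q)%:R / ln n%:R) (fun n => ln (d n)%:R / ln n%:R).
apply.
- near=> n.
  have n1 : (1 < n)%N by near: n; exact: nbhs_infty_gt.
  have ln0 : 0 < ln n%:R :> R by rewrite ln_gt0 // ltr1n.
  have /andP[pd dq] := pdq n.
  (* For positive [n] the lower bound forces [p] and [d n] to be positive, as the rules for [ln]
     require. *)
  have [p0 d0] : (0 < p)%N /\ (0 < d n)%N.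
    by apply/andP; rewrite -muln_gt0 (leq_trans _ pd) // ltnW.
  have q0 : (0 < q)%N.
    by case: q dq d0 {pdq} => //; rewrite mul0n leqn0 => /eqP ->.
  have pos k : (0 < k)%N -> (k%:R : R) \is Num.pos by rewrite posrE ltr0n.
  apply/andP; split.
    rewrite -[X in X - _](divff (lt0r_neq0 ln0)) -mulrBl ler_pM2r ?invr_gt0 //.
    rewrite lerBlDl -lnM ?pos // -natrM.
    by rewrite ler_ln ?pos ?muln_gt0 ?p0 ?(ltnW n1) // ler_nat.
  rewrite /= -[X in X + _](divff (lt0r_neq0 ln0)) -mulrDl ler_pM2r ?invr_gt0 //.
  rewrite -lnM ?pos ?muln_gt0 ?q0 ?(ltnW n1) // -natrM.
  rewrite ler_ln ?pos ?muln_gt0 ?q0 ?(ltnW n1) // ler_nat (leq_trans dq) //.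
  by rewrite mulnA [leqRHS]mulnC leq_mul2l muln2 -addnn -addn1 leq_add2l ltnW
    ?orbT.
- rewrite -[X in _ --> X]subr0; apply: cvgB; first exact: cvg_cst.
  exact: cvg_div_ln_nat.
- rewrite -[X in _ --> X]addr0; apply: cvgD; first exact: cvg_cst.
  exact: cvg_div_ln_nat.
Unshelve. all: by end_near. Qed.

Theorem corollary4p8 (R : realType) (F : fieldType)
    (F_char0 : [pchar F]%R =i pred0) :
  GKdim R (env_gens F) = 1%E.
Proof.
have [a3 b3 aab bba] := env_cubic_relations F_char0.
pose d n := dimension (growth_space (env_gens F) n).
(* The 2 comes from n <= 2 (floor(n/2) + 1), the 9 from the pairs of exponents of [a] and [b]. *)
have d_bounds n : (n <= 2 * d n)%N && (d n <= 9 * n.+1)%N.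
  have /andP[nd ->] := growth_space_dimension a3 b3 aab bba n
    (env_expx_indep F_char0).
  rewrite andbT (leq_trans _ (leq_mul (leqnn 2) nd)) // mul2n doubleS.
  by rewrite -[leqLHS]odd_double_half -add2n leq_add2r; case: (odd n).
(* The ratio converges, so its upper limit is its limit. *)
apply: (cvg_limn_einf_sup _).2.
apply: cvg_EFin; first exact: nearW.
exact: ln_linear_growth_cvg d_bounds.
Qed.
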